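(* Let $F$ be a contracting normal velocity that is homogeneous of degree one. Then there exists no maximum-principle function (MPF) for $F$.
   Context: Notation: $\mathbb{R}^2_+=(0,\infty)^2$; subscripts $a,b$ denote partial derivatives. Normal velocity: a symmetric function $F\in C^2(\mathbb{R}^2_+)$, homogeneous of some degree $\sigma\in\mathbb{R}\setminus\{0\}$, with $F_a,F_b>0$ for all $a,b>0$. It is contracting if $F>0$ everywhere on $\mathbb{R}^2_+$ and expanding if $F<0$ everywhere on $\mathbb{R}^2_+$. Maximum-principle function (MPF) for a normal velocity $F$: a symmetric function $w\in C^2(\mathbb{R}^2_+)$, homogeneous of some degree $\chi\in\mathbb{R}\setminus\{0\}$, such that, with $\alpha=-w_a/w_b$ and $\alpha_a=\partial\alpha/\partial a$ (defined for $a\ne b$): (1) $w>0$ whenever $a\neq b$, and $w=0$ whenever $a=b$. (2) $\chi>0$ if $F$ is contracting, $\chi<0$ if $F$ is expanding. (3) $w_a<0$ for all $0<a<b$, and $w_a>0$ for all $0<b<a$. (4) For all $a,b>0$ (for $E_w,G_w$: $a\neq b$) one has $C_w(a,b)\le0$, $E_w(a,b)\le0$, $G_w(a,b)\le 0$, where $$C_w=w_a\,a\big((F_aa^2+F_bb^2)+(F-F_aa-F_bb)a\big)+w_b\,b\big((F_aa^2+F_bb^2)+(F-F_aa-F_bb)b\big),$$ $$E_w=w_a(F_{aa}+2F_{ab}\alpha+F_{bb}\alpha^2)-F_a(w_{aa}+2w_{ab}\alpha+w_{bb}\alpha^2)+2\,\frac{w_bF_a-w_aF_b}{a-b}\,\alpha^2,$$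 $$G_w=\frac1{\alpha^2}\Big(w_b(F_{aa}+2F_{ab}\alpha+F_{bb}\alpha^2)-F_b(w_{aa}+2w_{ab}\alpha+w_{bb}\alpha^2)+2\,\frac{w_bF_a-w_aF_b}{a-b}\Big).$$ (5) There are constants $c>0$, $d\in\mathbb{R}$ such that, evaluating $\alpha$ and $\alpha_a$ at $(a,b)=(\rho,1)$ with $0<\rho<1$: if $F$ is contracting, then either $\alpha=c$ and $\alpha_a=0$ for all sufficiently small $\rho$, or, as $\rho\to0$, $\alpha=\frac c\rho+o(\rho^{-1})$ and $\alpha_a=-\frac c{\rho^2}+o(\rho^{-1})$; if $F$ is expanding, then, as $\rho\to0$, either $\alpha=\frac c\rho+o(\rho^{-1})$ and $\alpha_a=-\frac c{\rho^2}+o(\rho^{-1})$, or $\alpha=\frac{c+d\rho}{\rho^2}+o(\rho^{-1})$ and $\alpha_a=-\frac{2c+d\rho}{\rho^3}+o(\rho^{-1})$. *)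

(* Defs.v *)
From Stdlib Require Import Reals.
From Coquelicot Require Import Coquelicot.
Open Scope R_scope.

(** Functions on the open quadrant [(0, oo)^2] are total functions
    [R -> R -> R] whose values are only ever constrained on the quadrant.
    As the quadrant is open, [Derive] at one of its points does not depend on
    the values outside. *)

Definition da (f : R -> R -> R) (a b : R) : R := Derive (fun x => f x b) a.
Definition db (f : R -> R -> R) (a b : R) : R := Derive (fun y => f a y) b.

Definition C2_quadrant (f : R -> R -> R) : Prop :=
  forall a b, 0 < a -> 0 < b -> ex_diff_n f 2 a b.

Definition symmetric_quadrant (f : R -> R -> R) : Prop :=
  forall a b, 0 < a -> 0 < b -> f a b = f b a.

Definition homogeneous (f : R -> R -> R) (s : R) : Prop :=
  forall t a b, 0 < t -> 0 < a -> 0 < b ->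
    f (t * a) (t * b) = Rpower t s * f a b.

Record normal_velocity (F : R -> R -> R) : Prop := {
  nv_C2 : C2_quadrant F;
  nv_symmetric : symmetric_quadrant F;
  nv_homogeneous : exists sigma, sigma <> 0 /\ homogeneous F sigma;
  nv_increasing : forall a b, 0 < a -> 0 < b -> 0 < da F a b /\ 0 < db F a b
}.

Definition contracting (F : R -> R -> R) : Prop :=
  forall a b, 0 < a -> 0 < b -> 0 < F a b.

Definition expanding (F : R -> R -> R) : Prop :=
  forall a b, 0 < a -> 0 < b -> F a b < 0.

(** Only meaningful for [a <> b], where [db w a b] does not vanish for the
    functions [w] considered below. *)
Definition alpha (w : R -> R -> R) (a b : R) : R := - da w a b / db w a b.

Definition C_w (F w : R -> R -> R) (a b : R) : R :=
  let Fa := da F a b in let Fb := db F a b in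
  let S := Fa * a ^ 2 + Fb * b ^ 2 in
  let D := F a b - Fa * a - Fb * b in
  da w a b * a * (S + D * a) + db w a b * b * (S + D * b).

(** [f_aa + 2 f_ab alpha + f_bb alpha^2], with [alpha = alpha w]. *)
Definition second_order (f w : R -> R -> R) (a b : R) : R :=
  da (da f) a b + 2 * db (da f) a b * alpha w a b
    + db (db f) a b * alpha w a b ^ 2.

Definition E_w (F w : R -> R -> R) (a b : R) : R :=
  da w a b * second_order F w a b - da F a b * second_order w w a b
    + 2 * ((db w a b * da F a b - da w a b * db F a b) / (a - b))
        * alpha w a b ^ 2.

Definition G_w (F w : R -> R -> R) (a b : R) : R :=
  1 / alpha w a b ^ 2 *
    (db w a b * second_order F w a b - db F a b * second_order w w a b
       + 2 * ((db w a b * da F a b - da w a b * db F a b) / (a - b))).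

(** [f rho = g rho + o(1 / rho)] as [rho] tends to [0] from the right. *)
Definition eq_up_to_o_inv (f g : R -> R) : Prop :=
  is_domin (at_right 0) (fun rho : R => / rho) (fun rho : R => f rho - g rho).

Definition asymp_eventually_const (w : R -> R -> R) (c : R) : Prop :=
  at_right 0 (fun rho => alpha w rho 1 = c /\ da (alpha w) rho 1 = 0).

Definition asymp_order1 (w : R -> R -> R) (c : R) : Prop :=
  eq_up_to_o_inv (fun rho => alpha w rho 1) (fun rho => c / rho) /\
  eq_up_to_o_inv (fun rho => da (alpha w) rho 1) (fun rho => - (c / rho ^ 2)).

Definition asymp_order2 (w : R -> R -> R) (c d : R) : Prop :=
  eq_up_to_o_inv (fun rho => alpha w rho 1)
                 (fun rho => (c + d * rho) / rho ^ 2) /\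
  eq_up_to_o_inv (fun rho => da (alpha w) rho 1)
                 (fun rho => - ((2 * c + d * rho) / rho ^ 3)).

Record MPF (F w : R -> R -> R) : Prop := {
  mpf_C2 : C2_quadrant w;
  mpf_symmetric : symmetric_quadrant w;
  mpf_homogeneous : exists chi, chi <> 0 /\ homogeneous w chi /\
    (contracting F -> 0 < chi) /\ (expanding F -> chi < 0);
  mpf_positive : forall a b, 0 < a -> 0 < b -> a <> b -> 0 < w a b;
  mpf_diagonal : forall a, 0 < a -> w a a = 0;
  mpf_da_neg : forall a b, 0 < a -> a < b -> da w a b < 0;
  mpf_da_pos : forall a b, 0 < b -> b < a -> 0 < da w a b;
  mpf_C_w : forall a b, 0 < a -> 0 < b -> C_w F w a b <= 0;
  mpf_E_w : forall a b, 0 < a -> 0 < b -> a <> b -> E_w F w a b <= 0;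
  mpf_G_w : forall a b, 0 < a -> 0 < b -> a <> b -> G_w F w a b <= 0;
  mpf_asymptotics : exists c d, 0 < c /\
    (contracting F -> asymp_eventually_const w c \/ asymp_order1 w c) /\
    (expanding F -> asymp_order1 w c \/ asymp_order2 w c d)
}.

(* Main.v *)
Require Import Defs.
From Stdlib Require Import Reals Lra.
From Coquelicot Require Import Coquelicot.
Open Scope R_scope.

(** In degree one Euler's relation [F = a F_a + b F_b] kills the second term of
    each bracket of [C_w], so that [C_w = (a^2 F_a + b^2 F_b) (a w_a + b w_b)],
    which is [chi w (a^2 F_a + b^2 F_b)] by Euler's relation for [w]. Off the
    diagonal this is positive, against condition (4). *)

Lemma locally_2d_quadrant (a b : R) : 0 < a -> 0 < b ->
  locally_2d (fun u v => 0 < u /\ 0 < v) a b.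
Proof.
intros Ha Hb.
exists (mkposreal _ (Rmin_pos _ _ Ha Hb)); simpl; intros u v Hu Hv.
apply Rabs_def2 in Hu; apply Rabs_def2 in Hv.
pose proof (Rmin_l a b); pose proof (Rmin_r a b); lra.
Qed.

(** Total differentiability needs only that [da f] is the first partial near the point and is
    continuous there, and that the second partial exists at the point itself. *)
Lemma C2_quadrant_differentiable (f : R -> R -> R) (a b : R) :
  C2_quadrant f -> 0 < a -> 0 < b ->
  differentiable_pt_lim f a b (da f a b) (db f a b).
Proof.
intros Hf Ha Hb.
destruct (Hf a b Ha Hb) as (_ & _ & Hfb & (Hfa_cont & _) & _).
apply filterdiff_differentiable_pt_lim.
apply (is_derive_filterdiff f a b (da f) (db f a b)).
- apply (locally_2d_locally
    (fun u v => is_derive (fun z => f z v) u (da f u v))).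
  apply locally_2d_impl with (2 := locally_2d_quadrant a b Ha Hb).
  apply locally_2d_forall; intros u v [Hu Hv].
  destruct (Hf u v Hu Hv) as (_ & Hfu & _).
  now apply Derive_correct.
- now apply Derive_correct.
- now apply continuity_2d_pt_filterlim in Hfa_cont.
Qed.

(** Both sides of [f (t * a) (t * b) = Rpower t s * f a b] are differentiated in [t] at [t = 1]. *)
Lemma homogeneous_euler (f : R -> R -> R) (s a b : R) :
  C2_quadrant f -> homogeneous f s -> 0 < a -> 0 < b ->
  da f a b * a + db f a b * b = s * f a b.
Proof.
intros Hf Hs Ha Hb.
assert (Hray : is_derive (fun t => f (t * a) (t * b)) 1
                 (da f a b * a + db f a b * b)).
{ apply is_derive_Reals.
  apply (derivable_pt_lim_comp_2d f (fun t => t * a) (fun t => t * b)).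
  - rewrite !Rmult_1_l; now apply C2_quadrant_differentiable.
  - apply is_derive_Reals; auto_derive; [easy | ring].
  - apply is_derive_Reals; auto_derive; [easy | ring]. }
assert (Hpow : is_derive (fun t => Rpower t s * f a b) 1 (s * f a b)).
{ replace (s * f a b) with (s * Rpower 1 (s - 1) * f a b)
    by (unfold Rpower; rewrite ln_1, Rmult_0_r, exp_0; ring).
  apply (is_derive_scal_l (fun t => Rpower t s) 1 _ (f a b)).
  apply is_derive_Reals, derivable_pt_lim_power, Rlt_0_1. }
rewrite <- (is_derive_unique _ _ _ Hray), <- (is_derive_unique _ _ _ Hpow).
(* Homogeneity gives equality only for [t > 0], which is a neighbourhood of [1]. *)
apply Derive_ext_loc.
apply filter_imp with (2 := open_gt 0 1 Rlt_0_1); intros t Ht.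
now apply Hs.
Qed.

Theorem lemma5p5 (F : R -> R -> R)
  (hF : normal_velocity F) (hcontr : contracting F) (hdeg : homogeneous F 1) :
  ~ exists w : R -> R -> R, MPF F w.
Proof.
intros [w Hw].
destruct (mpf_homogeneous F w Hw) as (chi & _ & Hchi & Hpos & _).
specialize (Hpos hcontr).
(* One off-diagonal point suffices for the contradiction; [(1, 2)] is chosen. *)
assert (H1 : 0 < 1) by lra; assert (H2 : 0 < 2) by lra.
pose proof (homogeneous_euler F 1 1 2 (nv_C2 F hF) hdeg H1 H2) as EF.
pose proof (homogeneous_euler w chi 1 2 (mpf_C2 F w Hw) Hchi H1 H2) as Ew.
pose proof (mpf_C_w F w Hw 1 2 H1 H2) as HC.
destruct (nv_increasing F hF 1 2 H1 H2) as [HFa HFb].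
assert (Hw12 : 0 < w 1 2) by (apply (mpf_positive F w Hw); lra).
assert (HS : 0 < da F 1 2 * 1 ^ 2 + db F 1 2 * 2 ^ 2) by lra.
apply (Rle_not_lt _ _ HC); unfold C_w; cbv zeta.
(* This is [EF], where the degree of [F] being one is used. *)
replace (F 1 2 - da F 1 2 * 1 - db F 1 2 * 2) with 0 by lra.
replace (da w 1 2 * 1 * _ + db w 1 2 * 2 * _)
  with ((da F 1 2 * 1 ^ 2 + db F 1 2 * 2 ^ 2) * (chi * w 1 2))
  by (rewrite <- Ew; ring).
now apply Rmult_lt_0_compat, Rmult_lt_0_compat.
Qed.
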